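(* Let $D$ be a divisible abelian group and let $G=\bigoplus_{i\in I}A_i$ be a fully decomposable reduced subgroup of $D$, where every $A_i$ is (isomorphic to) a nonzero subgroup of $\mathbb{Q}$. Endow $G$ and $D$ with their coarse structures $\mathcal{E}_{r_0,\omega}$. Suppose that one of the following conditions holds: (i) $I$ is uncountable; (ii) $G$ is homogeneous, i.e. the groups $A_i$ ($i\in I$) are pairwise isomorphic. Then the following properties are equivalent: (a) the inclusion $j\colon G\hookrightarrow D$ is a coarse equivalence; (b) there exists a homomorphism $f\colon G\to D$ that is a coarse equivalence; (c) $G$ and $D$ are bounded coarse spaces; (d) $r_0(G)<\infty$ and $r_0(D)<\infty$.
   Context: For an abelian group $A$, $r_0(A)$ denotes the free rank (the cardinality of a maximal independent subset). An abelian group $A$ is divisible if for every $y\in A$ and every positive integer $n$ there is $x\in A$ with $nx=y$; it is reduced if its largest divisible subgroup is $\{0\}$. A torsion-free group is fully decomposable if it is a direct sum of subgroups of $\mathbb{Q}$. The coarse structure $\mathcal{E}_{r_0,\omega}$ on an abelian group $A$ is the family of all $E\subseteq A\times A$ for which there is a subgroup $H\le A$ with $r_0(H)<\omega$ and $E\subseteq\{(a,a+h)\mid a\in A,h\in H\}$. A coarse space $(X,\mathcal{E})$ is bounded if there are $x\in X$ and $E\in\mathcal{E}$ with $X=E[x]:=\{y\mid(x,y)\in E\}$. Maps $f,g\colon S\to(X,\mathcal{E})$ are close, $f\sim g$, if $\{(f(s),g(s))\mid s\in S\}\in\mathcal{E}$. A map $f\colon(X,\mathcal{E}_X)\to(Y,\mathcal{E}_Y)$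 is bornologous if $(f\times f)(E)\in\mathcal{E}_Y$ for all $E\in\mathcal{E}_X$, and a coarse equivalence if it is bornologous and there is a bornologous $g\colon Y\to X$ with $g\circ f\sim\mathrm{id}_X$, $f\circ g\sim\mathrm{id}_Y$. *)

(* Defs.v *)
(* MathComp / MathComp-Analysis. *)
From HB Require Import structures.
From mathcomp Require Import all_boot all_order all_algebra.
From mathcomp Require Import boolp classical_sets functions cardinality fsbigop.

Set Implicit Arguments.
Unset Strict Implicit.
Unset Printing Implicit Defensive.

Import GRing.Theory.
Local Open Scope classical_set_scope.
Local Open Scope ring_scope.

(* Abelian groups are zmodTypes, possibly infinite, and the subgroups of A are
   the inhabitants of zmodClosed A.  [subgrp H] is H as a group in its own
   right; the inclusion of H into A is \val. *)
Definition subgrp (A : zmodType) (H : zmodClosed A) : Type :=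
  {x : A | x \in H}.

HB.instance Definition _ (A : zmodType) (H : zmodClosed A) :=
  SubChoice.on (subgrp H).
HB.instance Definition _ (A : zmodType) (H : zmodClosed A) :=
  [SubChoice_isSubZmodule of subgrp H by <:].

Definition isomorphic (A B : zmodType) : Prop :=
  exists f : {additive A -> B}, bijective f.

Definition divisible (A : zmodType) : Prop :=
  forall (y : A) (n : nat), (0 < n)%N -> exists x : A, x *+ n = y.

(* The trivial subgroup is always divisible, so it is the largest divisible
   subgroup as soon as it contains all the others. *)
Definition reduced (A : zmodType) : Prop :=
  forall H : zmodClosed A, divisible (subgrp H) ->
  forall x : A, x \in H -> x = 0.

(* Independence over the integers: it is the coefficients that vanish, not
   only the terms, so that elements of finite order are excluded. *)
Definition independent (A : zmodType) (X : set A) : Prop :=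
  forall (s : seq A) (k : A -> int), uniq s -> {in s, forall x, X x} ->
  \sum_(x <- s) x *~ k x = 0 -> {in s, forall x, k x = 0}.

Definition maximal_independent (A : zmodType) (X : set A) : Prop :=
  independent X /\ forall Y : set A, independent Y -> X `<=` Y -> Y = X.

(* r_0(A) < omega.  Maximal independent subsets exist and all have the same
   cardinality, so one of them is finite iff all of them are. *)
Definition finite_free_rank (A : zmodType) : Prop :=
  exists2 X : set A, maximal_independent X & finite_set X.

(* A is the internal direct sum of the subgroups B i. *)
Definition direct_sum (A : zmodType) (I : choiceType) (B : I -> zmodClosed A) :
    Prop :=
  forall a : A, exists! x : I -> A,
    [/\ forall i, x i \in B i,
        finite_set [set i | x i <> 0]
      & a = \sum_(i \in [set: I]) x i].

Definition rational_rank1 (A : zmodType) : Prop :=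
  exists2 B : zmodClosed rat, (exists2 b, b \in B & b != 0)
                            & isomorphic A (subgrp B).

(* A coarse structure on X is given by its family of entourages. *)
Definition coarse_bounded (X : Type) (EX : set (set (X * X))) : Prop :=
  exists x E, EX E /\ [set: X] = [set y | E (x, y)].

Definition close (S X : Type) (EX : set (set (X * X))) (f g : S -> X) : Prop :=
  EX [set (f s, g s) | s in [set: S]].

Definition bornologous (X Y : Type) (EX : set (set (X * X)))
    (EY : set (set (Y * Y))) (f : X -> Y) : Prop :=
  forall E, EX E -> EY [set (f p.1, f p.2) | p in E].

Definition coarse_equivalence (X Y : Type) (EX : set (set (X * X)))
    (EY : set (set (Y * Y))) (f : X -> Y) : Prop :=
  bornologous EX EY f /\
  exists g : Y -> X,
    [/\ bornologous EY EX g, close EX (g \o f) id & close EY (f \o g) id].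

(* The coarse structure E_{r_0, omega}. *)
Definition coarse_r0 (A : zmodType) : set (set (A * A)) :=
  [set E | exists2 H : zmodClosed A, finite_free_rank (subgrp H)
         & E `<=` [set p | exists a h, h \in H /\ p = (a, a + h)]].
Arguments coarse_r0 : clear implicits.

(* Main.v *)
Require Import Defs.
From HB Require Import structures.
From mathcomp Require Import all_boot all_order all_algebra.
From mathcomp Require Import boolp classical_sets functions cardinality fsbigop.

Set Implicit Arguments.
Unset Strict Implicit.
Unset Printing Implicit Defensive.

Import GRing.Theory.
Local Open Scope classical_set_scope.
Local Open Scope ring_scope.

(** The heart of the matter is that a homomorphism [f : G -> D] which is a
    coarse equivalence forces the index set [I] to be finite.

    Let [g] be a coarse inverse of [f].  Since [f \o g] is close to the
    identity, there is a subgroup [K] of [D] of finite free rank with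
    [d - f (g d)] in [K] for all [d], so that [f(G) + K = D].  Put
    [L = f^-1(K)].  As [D = f(G) + K] is divisible, so is [G / L]:  given [x]
    and [n], write [f x = n d]; then [f (x - n (g d)) = n (d - f (g d))] lies in
    [K].  On the other hand [L] is small: since [g] is bornologous and
    [g \o f] is close to the identity, every [x] in [L] is a sum
    [(x - g (f x)) + (g (f x) - g 0) + g 0] of elements of two fixed subgroups
    of [G] of finite free rank.

    A subgroup of finite free rank of a direct sum of torsion-free groups is
    supported on a finite set of indices: every element of it has a nonzero
    multiple in the span of finitely many elements, and the elements supported
    on a given set of indices form a pure subgroup.  Hence [L] has its support
    in a finite [F].  For [i] outside [F] the [i]-th coordinate kills [L], so
    [A i] is a quotient of the divisible group [G / L] and is divisible; as [G]
    is reduced, [A i = 0], against the choice of [A i]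
    (divisible_quotient_finite_index).  So [I] is contained in [F], the free
    rank of [G] is finite, and so is that of [D = f(G) + K]
    (hom_coarse_equivalence_finite_rank).

    The other implications are formal: a group is coarsely bounded exactly when
    its free rank is finite, and then all relations on it are entourages, so
    that any map between two such groups is a coarse equivalence. *)

(** * Pure subgroups *)

(** Stronger than purity in the usual sense: the quotient is torsion-free, so
    all elements of finite order belong to it.  The two notions agree in
    torsion-free groups; in general this one is what ignores torsion, as the
    free rank does. *)
Definition pure_subgroup (M : zmodType) (P : set M) : Prop :=
  [/\ P 0, forall x y, P x -> P y -> P (x - y)
    & forall x n, (0 < n)%N -> P (x *+ n) -> P x].

Definition pure_hull (M : zmodType) (S : set M) : set M :=
  [set x | forall P, pure_subgroup P -> S `<=` P -> P x].

Lemma pure_subgroupD (M : zmodType) (P : set M) x y :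
  pure_subgroup P -> P x -> P y -> P (x + y).
Proof.
move=> [P0 PB _] Px Py; rewrite -[y]opprK; apply: (PB) => //.
by rewrite -sub0r; apply: (PB).
Qed.

Lemma pure_subgroup_sum (M : zmodType) (P : set M) (J : eqType) (r : seq J)
    (Q : pred J) (F : J -> M) :
  pure_subgroup P -> (forall j, j \in r -> Q j -> P (F j)) ->
  P (\sum_(j <- r | Q j) F j).
Proof.
move=> pureP PF; have [P0 _ _] := pureP.
rewrite big_seq_cond; elim/big_ind: _ => //.
  by move=> x y; apply: pure_subgroupD.
by move=> j /andP[jr Qj]; apply: PF.
Qed.

Lemma pure_subgroupMz (M : zmodType) (P : set M) x (m : int) :
  pure_subgroup P -> P x -> P (x *~ m).
Proof.
move=> pureP Px; have [P0 PB _] := pureP.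
have PMn n : P (x *+ n).
  by elim: n => [|n IHn]; rewrite ?mulr0n ?mulrS //; apply: pure_subgroupD.
case: m => n; first exact: PMn.
by rewrite NegzE mulrNz -sub0r; apply: (PB) => //; apply: PMn.
Qed.

Lemma pure_subgroupMz_inv (M : zmodType) (P : set M) x (m : int) :
  pure_subgroup P -> m != 0 -> P (x *~ m) -> P x.
Proof.
move=> [P0 PB Pdiv]; case: m => n nz Pxm.
  by apply: (Pdiv x n) => //; rewrite lt0n.
apply: (Pdiv x n.+1) => //.
by rewrite -[_ *+ _]opprK -sub0r; apply: (PB).
Qed.

Lemma pure_subgroup_preim (M N : zmodType) (f : {additive M -> N})
    (P : set N) : pure_subgroup P -> pure_subgroup (f @^-1` P).
Proof.
move=> [P0 PB Pdiv]; split => [|x y Px Py|x n n0].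
- by rewrite /preimage /= raddf0.
- by rewrite /preimage /= raddfB; apply: (PB).
- by rewrite /preimage /= raddfMn; apply: Pdiv.
Qed.

Lemma pure_hull_min (M : zmodType) (S P : set M) :
  pure_subgroup P -> S `<=` P -> pure_hull S `<=` P.
Proof. by move=> pureP SP x; apply. Qed.

Lemma pure_hull_sub (M : zmodType) (S : set M) : S `<=` pure_hull S.
Proof. by move=> x Sx P _; apply. Qed.

Lemma pure_hullP (M : zmodType) (S : set M) : pure_subgroup (pure_hull S).
Proof.
split=> [P [] //|x y Sx Sy P pureP SP|x n n0 Sx P pureP SP].
- by have [_ PB _] := pureP; apply: (PB); [apply: Sx|apply: Sy].
- by have [_ _ Pdiv] := pureP; apply: (Pdiv x n) => //; apply: Sx.
Qed.

Lemma pure_hull_morph (M N : zmodType) (f : {additive M -> N}) (S : set M)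
    (x : M) : pure_hull S x -> pure_hull (f @` S) (f x).
Proof.
move=> Sx P pureP SP; apply: (Sx _ (pure_subgroup_preim f pureP)) => y Sy.
by apply: SP; exists y.
Qed.

(** The relation is indexed by [undup s] because the coefficients are a function
    of the elements: a repeated entry would count its coefficient twice. *)
Lemma pure_hull_seqP (M : zmodType) (s : seq M) (x : M) :
  pure_hull [set` s] x -> exists (n : nat) (k : M -> int),
    (0 < n)%N /\ x *+ n = \sum_(y <- undup s) y *~ k y.
Proof.
(* The elements satisfying such a relation form a pure subgroup. *)
pose P : set M := [set x | exists (n : nat) (k : M -> int),
  (0 < n)%N /\ x *+ n = \sum_(y <- undup s) y *~ k y].
apply: (pure_hull_min (P := P)).
  split.
  - exists 1%N, (fun=> 0); split=> //.
    by rewrite mul0rn big1 // => y _; rewrite mulr0z.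
  - move=> u v [n [k [n0 uE]]] [m [l [m0 vE]]].
    exists (n * m)%N, (fun y => k y * m%:Z - l y * n%:Z).
    split; first by rewrite muln_gt0 n0.
    rewrite mulrnBl mulrnA uE [(n * m)%N]mulnC mulrnA vE.
    rewrite -!sumrMnl -sumrB; apply: eq_bigr => y _.
    by rewrite mulrzBr !mulrzA.
  - move=> u m m0 [n [k [n0 uE]]]; exists (m * n)%N, k.
    by rewrite muln_gt0 m0 n0 mulrnA.
move=> y ys; exists 1%N, (fun z => (z == y)%:Z); split=> //.
rewrite (bigD1_seq y) /= ?undup_uniq ?mem_undup // eqxx mulr1z.
by rewrite big1 ?addr0 // => z /negPf ->; rewrite mulr0z.
Qed.

(** * Finite free rank *)

(** In a relation between [x] and elements of [X] with a nonzero coefficient at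
    [x], a nonzero multiple of [x] is expressed by elements of [X]; if the
    coefficient at [x] vanishes the relation is one between elements of [X]. *)
Lemma independentU1 (M : zmodType) (X : set M) (x : M) :
  independent X -> ~ pure_hull X x -> independent (x |` X).
Proof.
move=> indX x_notin s k us sX sum0.
have kx0 : x \in s -> k x = 0.
  move=> xs; apply: contrapT => /eqP kx; apply: x_notin => P pureP XP.
  apply: (pure_subgroupMz_inv pureP kx).
  move: sum0; rewrite (bigD1_seq x) //= => /eqP; rewrite addr_eq0 => /eqP ->.
  have [P0 PB _] := pureP; rewrite -sub0r; apply: (PB) => //.
  apply: pure_subgroup_sum => // y ys yx; apply: pure_subgroupMz => //.
  by apply: XP; have [yE|//] := sX _ ys; rewrite yE eqxx in yx.
move=> y ys; have [yx|yx] := eqVneq y x.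
  by rewrite yx in ys *; apply: kx0.
apply: (indX [seq z <- s | z != x] k).
- exact: filter_uniq.
- move=> z; rewrite mem_filter => /andP[zx zs].
  by have [zE|//] := sX _ zs; rewrite zE eqxx in zx.
- rewrite -[RHS]sum0 big_filter big_mkcond; apply: eq_big_seq => z zs /=.
  by case: eqVneq zs => [->|//] /kx0 ->; rewrite mulr0z.
- by rewrite mem_filter yx.
Qed.

Lemma seq_pure_basis (M : zmodType) (s : seq M) :
  exists2 t : seq M, independent [set` t]
                   & [set` s] `<=` pure_hull [set` t].
Proof.
elim: s => [|x s [t indt st]].
  by exists [::] => // r k _ rs _ y /rs.
have [xt|xt] := pselect (pure_hull [set` t] x).
  by exists t => // y /=; rewrite inE => /predU1P[->//|/st].
have tE : [set` x :: t] = x |` [set` t].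
  apply/seteqP; split=> y /= => [|yx]; rewrite inE; first by move/predU1P.
  exact/predU1P.
exists (x :: t); first by rewrite tE; apply: independentU1.
move=> y /=; rewrite inE => /predU1P[->|/st].
  by apply: pure_hull_sub; rewrite /= mem_head.
apply: pure_hull_min => [|z zt]; first exact: pure_hullP.
by apply: pure_hull_sub; rewrite /= inE zt orbT.
Qed.

(** Being exhausted by the pure hull of finitely many elements is easier to
    handle than having a finite maximal independent set: it passes at once to
    images and to sums.  A maximal independent set has everything in its pure
    hull by independentU1; conversely an independent family extracted from
    finite generators is maximal, as any further element depends on it. *)
Lemma finite_free_rankP (M : zmodType) :
  finite_free_rank M <-> exists s : seq M, forall x, pure_hull [set` s] x.
Proof.
split=> [[X [indX maxX] /finite_seqP[s XE]]|[s sM]].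
  exists s => x; rewrite -XE; apply: contrapT => x_notin; apply: (x_notin).
  apply: pure_hull_sub.
  suff <- : x |` X = X by left.
  by apply: maxX => [|y Xy]; [apply: independentU1|right].
have [t indt st] := seq_pure_basis s.
have tM x : pure_hull [set` t] x.
  by apply: (pure_hull_min (pure_hullP _) st); apply: sM.
exists [set` t]; last exact: finite_seq.
split=> // Y indY tY; apply/seteqP; split=> // y Yy /=.
apply/negP => /negP y_notin.
have [n [k [n0 yE]]] := pure_hull_seqP (tM y).
(* A new element [y] of [Y] satisfies [n y = \sum_z k_z z] with [n > 0], a
   relation in [Y] whose coefficient at [y] is nonzero. *)
have := indY (y :: undup t) (fun z => if z == y then n%:Z else - k z).
have Y_sub : {in y :: undup t, forall x, Y x}.
  by move=> z; rewrite inE mem_undup => /predU1P[->//|/tY].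
have sum0 : \sum_(z <- y :: undup t) z *~ (if z == y then n%:Z else - k z) = 0.
  rewrite big_cons eqxx -[_ *~ n%:Z]/(y *+ n) yE -big_split big1_seq //= => z.
  rewrite mem_undup => zt; case: eqP => [zy|_]; last first.
    by rewrite mulrNz subrr.
  by rewrite -zy zt in y_notin.
rewrite /= mem_undup y_notin undup_uniq => /(_ isT Y_sub sum0 y).
by rewrite mem_head eqxx => /(_ isT) [n_eq0]; rewrite n_eq0 in n0.
Qed.

Lemma finite_free_rank_surj (M N : zmodType) (f : {additive M -> N}) :
  (forall y, exists x, f x = y) -> finite_free_rank M -> finite_free_rank N.
Proof.
move=> f_surj /finite_free_rankP[s sM]; apply/finite_free_rankP.
exists (map f s) => y; have [x <-] := f_surj y.
have <- : f @` [set` s] = [set` map f s].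
  apply/seteqP; split=> [_ [z zs <-]|z /mapP[u us ->]]; last by exists u.
  exact: map_f.
exact: pure_hull_morph.
Qed.

Lemma finite_free_rank_subgrp (M : zmodType) (H : zmodClosed M) :
  finite_free_rank (subgrp H) -> exists s : seq M,
    forall x, x \in H -> pure_hull [set` s] x.
Proof.
move=> /finite_free_rankP[s sH]; exists (map val s) => x xH.
have <- : (\val : subgrp H -> M) @` [set` s] = [set` map val s].
  apply/seteqP; split=> [_ [z zs <-]|z /mapP[u us ->]]; last by exists u.
  exact: map_f.
have := pure_hull_morph (f := \val : {additive subgrp H -> M}) (sH (Sub x xH)).
by [].
Qed.

(** * The coarse structure of finite-rank subgroups *)

(** Entourages are given by subgroups, so the total relation calls for the
    group as a subgroup of itself. *)
Definition whole (M : zmodType) : {pred M} := predT.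
Arguments whole : clear implicits.

Fact whole_zmod_closed (M : zmodType) : zmod_closed (whole M).
Proof. by []. Qed.

HB.instance Definition _ (M : zmodType) :=
  GRing.isZmodClosed.Build M (whole M) (whole_zmod_closed M).

Definition to_whole (M : zmodType) (x : M) : subgrp (whole M) :=
  Sub x (isT : x \in whole M).

Fact to_whole_zmod_morphism (M : zmodType) : zmod_morphism (@to_whole M).
Proof. by move=> x y; apply/val_inj. Qed.

HB.instance Definition _ (M : zmodType) :=
  GRing.isZmodMorphism.Build M (subgrp (whole M)) (@to_whole M)
    (@to_whole_zmod_morphism M).

Lemma coarse_r0_total (M : zmodType) (E : set (M * M)) :
  finite_free_rank M -> coarse_r0 M E.
Proof.
move=> finM; exists (whole M : zmodClosed M).
  apply: (finite_free_rank_surj (f := @to_whole M)) finM => y.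
  by exists (val y); apply/val_inj.
by move=> [x y] _; exists x, (y - x); rewrite subrKC.
Qed.

(** If [M] is the ball around [x] of an entourage given by [H], then [M = x + H]
    is a coset of [H], and [0] being in it, [M = H]. *)
Lemma coarse_bounded_finite_free_rank (M : zmodType) :
  coarse_bounded (coarse_r0 M) <-> finite_free_rank M.
Proof.
split=> [[x [E [[H finH EH] ME]]]|finM]; last first.
  by exists 0, setT; split; [apply: coarse_r0_total|apply/seteqP].
have xH y : y - x \in H.
  have /EH[a [h [hH [-> ->]]]] : E (x, y) by have: [set: M] y by []; rewrite ME.
  by rewrite addrAC subrr add0r.
apply: (finite_free_rank_surj (f := \val : {additive subgrp H -> M})) finH => y.
suff yH : y \in H by exists (Sub y yH).
have -> : y = (y - x) - (0 - x) by rewrite sub0r opprK subrK.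
by rewrite rpredB.
Qed.

Lemma close_coarse_r0 (S : Type) (M : zmodType) (f g : S -> M) :
  close (coarse_r0 M) f g ->
  exists2 H : zmodClosed M, finite_free_rank (subgrp H)
                          & forall s, g s - f s \in H.
Proof.
move=> [H finH fgH]; exists H => // s.
have /fgH[a [h [hH [-> ->]]]] : [set (f s, g s) | s in [set: S]] (f s, g s).
  by exists s.
by rewrite addrAC subrr add0r.
Qed.

Lemma bornologous_coarse_r0 (M N : zmodType) (g : M -> N) (K : zmodClosed M) :
  bornologous (coarse_r0 M) (coarse_r0 N) g -> finite_free_rank (subgrp K) ->
  exists2 H : zmodClosed N, finite_free_rank (subgrp H)
    & forall x y, y - x \in K -> g y - g x \in H.
Proof.
move=> g_born finK.
pose E : set (M * M) := [set p | exists a h, h \in K /\ p = (a, a + h)].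
have [|H finH EH] := g_born E; first by exists K.
exists H => // x y xyK.
have /EH[a [h [hH [-> ->]]]] : [set (g p.1, g p.2) | p in E] (g x, g y).
  by exists (x, y) => //; exists x, (y - x); rewrite subrKC.
by rewrite addrAC subrr add0r.
Qed.

(** * Coordinates in a direct sum *)

(** The sums range over all of [I], where finite support is what gives them a
    meaning; the subtraction is carried out over the union of both supports. *)
Lemma fsum_sub (M : zmodType) (I : choiceType) (x y : I -> M) :
  finite_set [set i | x i <> 0] -> finite_set [set i | y i <> 0] ->
  \sum_(i \in [set: I]) (x i - y i) =
  \sum_(i \in [set: I]) x i - \sum_(i \in [set: I]) y i.
Proof.
move=> finx finy.
have finU : finite_set ([set i | x i <> 0] `|` [set i | y i <> 0]).
  by rewrite finite_setU.
have /finite_seqP[r rE] := finU.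
have sum_r (z : I -> M) :
    (forall i, z i <> 0 -> x i <> 0 \/ y i <> 0) ->
  \sum_(i \in [set: I]) z i = \sum_(i <- undup r) z i.
  move=> z_supp; rewrite (fsbigE (undup r)) ?undup_uniq // => [|i _].
    by apply: eq_bigl => i; rewrite in_setT.
  rewrite mem_undup => /negP; apply: contra_notP => /z_supp xyi.
  by have : [set` r] i by rewrite -rE.
rewrite !sum_r ?sumrB //; do ?by move=> i; auto.
move=> i xyi; apply: contrapT => /not_orP[/contrapT x0 /contrapT y0].
by apply: xyi; rewrite x0 y0 subrr.
Qed.

Section Coordinates.
Context (M : zmodType) (I : choiceType) (A : I -> zmodClosed M).
Context (sumA : direct_sum A).

Definition coord (i : I) (x : M) : M := projT1 (cid (sumA x)) i.

Lemma coord_spec x : [/\ forall i, coord i x \in A i,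
  finite_set [set i | coord i x <> 0] & x = \sum_(i \in [set: I]) coord i x].
Proof. by rewrite /coord; case: cid => ? []. Qed.

Lemma coord_unique x (y : I -> M) : (forall i, y i \in A i) ->
  finite_set [set i | y i <> 0] -> x = \sum_(i \in [set: I]) y i ->
  forall i, coord i x = y i.
Proof.
move=> yA finy xE i; rewrite /coord; case: cid => c /= [_ c_uniq].
by rewrite (c_uniq y).
Qed.

Fact coord_zmod_morphism i : zmod_morphism (coord i).
Proof.
move=> x y.
have [xA finx xE] := coord_spec x; have [yA finy yE] := coord_spec y.
apply: (coord_unique (y := fun i => coord i x - coord i y)).
- by move=> j; rewrite rpredB.
- apply: (sub_finite_set (B := [set i | coord i x <> 0] `|`
                               [set i | coord i y <> 0])).
    move=> j /= xyj; apply: contrapT => /not_orP[/contrapT x0 /contrapT y0].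
    by apply: xyj; rewrite x0 y0 subrr.
  by rewrite finite_setU.
- by rewrite fsum_sub // -xE -yE.
Qed.

HB.instance Definition _ i :=
  GRing.isZmodMorphism.Build M M (coord i) (coord_zmod_morphism i).

Lemma coord_id i x : x \in A i -> coord i x = x.
Proof.
move=> xA.
rewrite (coord_unique (y := fun j => if j == i then x else 0)) ?eqxx //.
- by move=> j; case: eqP => [->//|_]; apply: rpred0.
- apply: (sub_finite_set (B := [set i])) (finite_set1 i) => j /=.
  by case: eqP.
- rewrite (fsbigE [:: i]) // => [|j _].
    by rewrite big_cons big_nil in_setT /= eqxx addr0.
  by rewrite inE => /negPf ->.
Qed.

Lemma coord_in i x : coord i x \in A i.
Proof. by have [] := coord_spec x. Qed.

(** Torsion-freeness of the summands is what makes these subgroups pure: if the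
    [i]-th coordinate of [n x] is zero, so is that of [x]. *)
Lemma pure_subgroup_coord (F : set I) :
  (forall i x n, (0 < n)%N -> x \in A i -> x *+ n = 0 -> x = 0) ->
  pure_subgroup [set x | forall i, ~ F i -> coord i x = 0].
Proof.
move=> torsA; split=> [i _|x y xF yF i iF|x n n0 xF i iF].
- exact: raddf0.
- by rewrite raddfB /= xF // yF // subrr.
- by apply: (torsA i _ _ n0 (coord_in i x)); rewrite -raddfMn; apply: xF.
Qed.

(** The subgroup lies in the pure hull of finitely many elements, hence in the
    pure subgroup supported on the union of their finite supports. *)
Lemma finite_free_rank_support (H : zmodClosed M) :
  (forall i x n, (0 < n)%N -> x \in A i -> x *+ n = 0 -> x = 0) ->
  finite_free_rank (subgrp H) ->
  exists2 F : set I, finite_set F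
    & forall x, x \in H -> forall i, ~ F i -> coord i x = 0.
Proof.
move=> torsA /finite_free_rank_subgrp[s sH].
pose F := \bigcup_(y in [set` s]) [set i | coord i y <> 0].
exists F.
  apply: bigcup_finite => [|y _]; first exact: finite_seq.
  by have [] := coord_spec y.
move=> x /sH; apply: (pure_hull_min (pure_subgroup_coord F torsA)).
by move=> y ys i iF; apply: contrapT => yi; apply: iF; exists y.
Qed.

End Coordinates.

(** * Groups isomorphic to a nonzero subgroup of the rationals *)

Lemma rational_rank1_torsion_free (B : zmodType) :
  rational_rank1 B -> forall (x : B) n, (0 < n)%N -> x *+ n = 0 -> x = 0.
Proof.
move=> [C _ [f /bij_inj f_inj]] x n n0 xn0.
apply: f_inj; rewrite raddf0; apply: val_inj; rewrite raddf0.
have /eqP : val (f x) *+ n = 0 by rewrite -!raddfMn xn0 !raddf0.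
by rewrite Num.Theory.mulrn_eq0 => /orP[/eqP n_eq0|/eqP//]; rewrite n_eq0 in n0.
Qed.

(** Any two nonzero rationals have a common nonzero integral multiple. *)
Lemma rational_rank1_generator (B : zmodType) :
  rational_rank1 B -> exists2 b : B, b != 0 & forall x, pure_hull [set b] x.
Proof.
move=> [C [q qC q_neq0] [f f_bij]].
have [g gK fK] := f_bij.
pose b := g (Sub q qC).
have bE : val (f b) = q by rewrite fK.
exists b.
  by apply: contraNneq q_neq0 => b0; rewrite -bE b0 !raddf0.
move=> x P pureP bP.
have [->|x_neq0] := eqVneq x 0; first by case: pureP.
(* If [f x = c / d] and [q = p / e], then [d p (f x)] and [e c q] are [c p]. *)
have nz : denq (val (f x)) * numq q != 0.
  by rewrite mulf_neq0 ?denq_eq0 ?numq_eq0.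
apply: (pure_subgroupMz_inv pureP nz).
suff -> : x *~ (denq (val (f x)) * numq q) = b *~ (denq q * numq (val (f x))).
  by apply: pure_subgroupMz => //; apply: bP.
apply: (bij_inj f_bij); apply: val_inj; rewrite !raddfMz /= bE.
rewrite -[in LHS]mulrzr -[in RHS]mulrzr !intrM !mulrA -!numqE.
by rewrite mulrC.
Qed.

(** * Coarse equivalences and finiteness of the rank *)

Lemma finite_direct_sum_rank (M : zmodType) (I : choiceType)
    (A : I -> zmodClosed M) (sumA : direct_sum A) :
  (forall i, rational_rank1 (subgrp (A i))) -> finite_set [set: I] ->
  finite_free_rank M.
Proof.
move=> ratA finI; have /finite_seqP[r rE] := finI.
have /choice[b bP] : forall i, exists b : M,
    forall x, x \in A i -> pure_hull [set b] x.
  move=> i; have [b _ bA] := rational_rank1_generator (ratA i).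
  exists (val b) => x xA.
  have := pure_hull_morph (f := \val : {additive subgrp (A i) -> M})
    (bA (Sub x xA)).
  by rewrite image_set1.
apply/finite_free_rankP; exists (map b r) => x.
have [_ _ ->] := coord_spec sumA x.
have in_r i : i \in r by have : [set: I] i by []; rewrite rE.
rewrite (fsbigE (undup r)) ?undup_uniq // => [|i _]; last first.
  by rewrite mem_undup in_r.
apply: pure_subgroup_sum; first exact: pure_hullP.
move=> i _ _.
apply: (pure_hull_min (pure_hullP _) _ (bP i _ (coord_in sumA i x))) => _ ->.
by apply: pure_hull_sub; apply: map_f.
Qed.

(** Here [L] is a set modulo which every element of [M] is divisible.  For an
    index [i] outside [F], taking the [i]-th coordinate of the division of
    [a] in [A i] divides [a] exactly, so [A i] is divisible, contradicting
    that [M] is reduced and [A i] nonzero. *)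
Lemma divisible_quotient_finite_index (M : zmodType) (I : choiceType)
    (A : I -> zmodClosed M) (sumA : direct_sum A) (L : set M) (F : set I) :
  reduced M -> (forall i, rational_rank1 (subgrp (A i))) ->
  (forall x n, (0 < n)%N -> exists y, L (x - y *+ n)) ->
  (forall x, L x -> forall i, ~ F i -> coord sumA i x = 0) ->
  finite_set F -> finite_set [set: I].
Proof.
move=> redM ratA divL suppL; apply: sub_finite_set => i _.
apply: contrapT => iF.
have divA : divisible (subgrp (A i)).
  move=> a n n0; have [y Ly] := divL (val a) n n0.
  have aE : val a = coord sumA i y *+ n.
    apply/eqP; rewrite -subr_eq0 -raddfMn.
    by rewrite -[val a](coord_id sumA (valP a)) -raddfB /= suppL.
  exists (Sub (coord sumA i y) (coord_in sumA i y)); apply: val_inj.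
  by rewrite raddfMn; apply/esym.
have [b b_neq0 _] := rational_rank1_generator (ratA i).
by move/eqP: b_neq0; apply; apply: val_inj; apply: (redM _ divA _ (valP b)).
Qed.

(** The preimage [L] of [K] under [f], where [K] bounds the distance from
    [f \o g] to the identity, has a divisible quotient and finite support; the
    previous lemma then makes the index set finite. *)
Lemma hom_coarse_equivalence_finite_rank (M D : zmodType) (I : choiceType)
    (A : I -> zmodClosed M) (f : {additive M -> D}) :
  divisible D -> reduced M -> direct_sum A ->
  (forall i, rational_rank1 (subgrp (A i))) ->
  coarse_equivalence (coarse_r0 M) (coarse_r0 D) f ->
  finite_free_rank M /\ finite_free_rank D.
Proof.
move=> divD redM sumA ratA [_ [g [g_born gf_close fg_close]]].
have [K finK fgK] := close_coarse_r0 fg_close.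
have [H finH gfH] := close_coarse_r0 gf_close.
have [H' finH' gH'] := bornologous_coarse_r0 g_born finK.
have torsA i x n : (0 < n)%N -> x \in A i -> x *+ n = 0 -> x = 0.
  move=> n0 xA xn0.
  suff /(congr1 val) : Sub x xA = 0 :> subgrp (A i) by [].
  apply: (rational_rank1_torsion_free (ratA i) n0); apply: val_inj.
  by rewrite raddfMn.
have [F finF HF] := finite_free_rank_support sumA torsA finH.
have [F' finF' HF'] := finite_free_rank_support sumA torsA finH'.
(* [H] bounds the distance from [g \o f] to the identity, and [H'] the image
   under [g] of pairs that differ by an element of [K]. *)
pose L : set M := [set x | f x \in K].
have L_supp x : L x -> forall i, ~ (F `|` F') i -> coord sumA i x = 0.
  move=> Lx i /not_orP[iF iF'].
  have gx0 : g (f x) - g 0 \in H' by apply: gH'; rewrite subr0.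
  have -> : x = (x - g (f x)) + (g (f x) - g 0) - (0 - g (f 0)).
    by rewrite raddf0 sub0r opprK addrA !subrK.
  rewrite raddfB raddfD /= (HF _ (gfH x)) // (HF' _ gx0) // (HF _ (gfH 0)) //.
  by rewrite addr0 subr0.
have L_div x n : (0 < n)%N -> exists y, L (x - y *+ n).
  move=> n0; have [d dE] := divD (f x) n n0; exists (g d).
  by rewrite /L /= raddfB raddfMn -dE -mulrnBl rpredMn //; apply: fgK.
have finI : finite_set [set: I].
  apply: (divisible_quotient_finite_index redM ratA L_div L_supp).
  by rewrite finite_setU.
have finM := finite_direct_sum_rank sumA ratA finI; split=> //.
have [s sM] := (finite_free_rankP M).1 finM.
have [t tK] := finite_free_rank_subgrp finK.
apply/finite_free_rankP; exists (map f s ++ t) => d.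
have pureS := pure_hullP [set` map f s ++ t].
rewrite -[d](subrK (f (g d))); apply: (pure_subgroupD pureS).
  apply: (pure_hull_min pureS _ (tK _ (fgK d))) => y yt.
  by apply: pure_hull_sub; rewrite /= mem_cat; apply/orP; right.
apply: (pure_hull_min pureS _ (pure_hull_morph (f := f) (sM (g d)))).
move=> _ [y ys <-].
by apply: pure_hull_sub; rewrite /= mem_cat map_f.
Qed.

Lemma finite_free_rank_coarse_equivalence (M N : zmodType) (f : M -> N) :
  finite_free_rank M -> finite_free_rank N ->
  coarse_equivalence (coarse_r0 M) (coarse_r0 N) f.
Proof.
move=> finM finN; split=> [E _|]; first exact: coarse_r0_total.
exists (fun=> 0); split=> [E _||]; exact: coarse_r0_total.
Qed.

Theorem theorem3p10 (D : zmodType) (G : zmodClosed D)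
    (I : choiceType) (A : I -> zmodClosed (subgrp G))
    (divD : divisible D)
    (redG : reduced (subgrp G))
    (sumG : direct_sum A)
    (ratA : forall i, rational_rank1 (subgrp (A i)))
    (hI : ~ countable [set: I] \/
          (forall i j, isomorphic (subgrp (A i)) (subgrp (A j)))) :
  [<-> coarse_equivalence (coarse_r0 (subgrp G)) (coarse_r0 D)
         (\val : subgrp G -> D);
       exists f : {additive subgrp G -> D},
         coarse_equivalence (coarse_r0 (subgrp G)) (coarse_r0 D) f;
       coarse_bounded (coarse_r0 (subgrp G)) /\ coarse_bounded (coarse_r0 D);
       finite_free_rank (subgrp G) /\ finite_free_rank D].
Proof.
tfae.
- by move=> incl_equiv; exists (\val : {additive subgrp G -> D}).
- move=> [f f_equiv].
  have [finG finD] :=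
    hom_coarse_equivalence_finite_rank divD redG sumG ratA f_equiv.
  by split; apply/coarse_bounded_finite_free_rank.
- by move=> [/coarse_bounded_finite_free_rank finG
             /coarse_bounded_finite_free_rank finD].
- by move=> [finG finD]; apply: finite_free_rank_coarse_equivalence.
Qed.
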